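(* Let $m\le n$ and let $F_1,\dots,F_m$ be real-valued functions, analytic in a neighborhood of $0\in\mathbb R^n$, with $F_u(0)=0$ for $u=1,\dots,m$. Write $$F_u(x)=l_u(x)+q_u(x)+o(\|x\|^2),$$ where $l_u$ is a linear form and $q_u$ a quadratic form on $\mathbb R^n$, and let $E=\bigcap_{u=1}^m\ker l_u$. Assume: (A) the linear space spanned by the linear forms $l_1,\dots,l_m$ is $(m-1)$-dimensional, and the (unique up to a factor) linear relation between them is strictly convex: $\lambda^1l_1+\dots+\lambda^ml_m=0$ with $\lambda^u>0$ for all $u=1,\dots,m$; (B) the only $\xi\in E$ satisfying $\lambda^1q_1(\xi)+\dots+\lambda^mq_m(\xi)\ge 0$ is $\xi=0$. Then the origin is a strict local maximum of the function $\mathsf F(x)=\min\{F_1(x),\dots,F_m(x)\}$. *)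

(* Defs.v *)
From HB Require Import structures.
From mathcomp Require Import all_boot all_order all_algebra.
From mathcomp Require Import all_classical all_reals all_analysis.
From mathcomp.analysis.showcase Require Import summability.

Set Implicit Arguments.
Unset Strict Implicit.
Unset Printing Implicit Defensive.

Import Order.TTheory GRing.Theory Num.Theory.
Import numFieldNormedType.Exports.

Local Open Scope classical_set_scope.
Local Open Scope ring_scope.

Definition monomial (R : realType) (n : nat) (k : {ffun 'I_n -> nat})
    (x : 'rV[R]_n) : R :=
  \prod_(i < n) x ord0 i ^+ k i.

(* The multiple series is summed unconditionally, i.e. along the net of finite
   sets of multi-indices; for real series this is absolute convergence. *)
Definition analytic_at (R : realType) (n : nat) (f : 'rV[R]_n -> R)
    (a : 'rV[R]_n) : Prop :=
  exists c : {ffun 'I_n -> nat} -> R,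
    \forall x \near a,
      partial_sum (fun k => c k * monomial k (x - a)) @ totally --> f x.

Definition is_quadratic_form (R : realType) (n : nat) (q : 'rV[R]_n -> R)
    : Prop :=
  exists B : {symmetric 'rV[R]_n}, forall x, q x = B x x.

Definition strict_local_max (R : realType) (n : nat) (f : 'rV[R]_n -> R)
    (a : 'rV[R]_n) : Prop :=
  \forall x \near a^', f x < f a.

(* Main.v *)
(* Let Q = sum_u lambda_u q_u.  If all F_u are nonnegative at a small x != 0,
   then l_u(x) >= - o(|x|), so the relation sum_u lambda_u l_u = 0 with positive
   weights forces every l_u(x) to be o(|x|); the same relation cancels the
   linear terms in sum_u lambda_u F_u(x) >= 0, leaving Q(x) >= - o(|x|^2).
   At xi = x/|x| this contradicts the positive lower bound, on the compact unit
   sphere, of sum_u lambda_u |l_u(xi)| + (|Q(xi)| - Q(xi)), which by (B) has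
   no zero there. *)
Require Import Defs.
From HB Require Import structures.
From mathcomp Require Import all_boot all_order all_algebra.
From mathcomp Require Import all_classical all_reals all_analysis.
From mathcomp Require Import ring lra.

Set Implicit Arguments.
Unset Strict Implicit.

Import Order.TTheory GRing.Theory Num.Theory.
Import numFieldNormedType.Exports.

Local Open Scope classical_set_scope.
Local Open Scope ring_scope.

Lemma ler_coord_norm (R : realType) (n : nat) (x : 'rV[R]_n) (i : 'I_n) :
  `|x ord0 i| <= `|x|.
Proof.
rewrite [leRHS]mx_normrE.
exact: (le_bigmax _ (fun ij : 'I_1 * 'I_n => `|x ij.1 ij.2|) (ord0, i)).
Qed.

Lemma continuous_mul (R : realType) (T : topologicalType) (f g : T -> R) :
  continuous f -> continuous g -> continuous (fun x => f x * g x).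
Proof. by move=> fc gc x; apply: cvgM; [exact: fc|exact: gc]. Qed.

Lemma continuous_abs (R : realType) (T : topologicalType) (f : T -> R) :
  continuous f -> continuous (fun x => `|f x|).
Proof. by move=> fc x; apply: cvg_norm; exact: fc. Qed.

Lemma continuous_bigsum (R : realType) (T : topologicalType) (I : finType)
    (f : I -> T -> R) :
  (forall i, continuous (f i)) -> continuous (fun x => \sum_i f i x).
Proof.
move=> fc x; rewrite /continuous_at.
by apply: cvg_big => [|i _]; [exact: add_continuous|exact: fc].
Qed.

Lemma linear_formZ (R : realType) (n : nat) (l : 'Hom('rV[R]_n, R^o)) a x :
  l (a *: x) = a * l x.
Proof. by rewrite linearZ. Qed.

(** In coordinates a linear form is a finite sum of multiples of the continuous coordinate
    functions. *)
Lemma linear_form_continuous (R : realType) (n : nat)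
    (l : 'Hom('rV[R]_n, R^o)) : continuous (fun x => l x : R).
Proof.
have -> : (fun x => l x : R) =
    (fun x => \sum_(i < n) x ord0 i * l (delta_mx ord0 i)).
  apply/funext => x; rewrite {1}(row_sum_delta x) linear_sum.
  by apply: eq_bigr => i _; exact: linear_formZ.
apply: continuous_bigsum => i; apply: continuous_mul; last exact: cst_continuous.
exact: coord_continuous.
Qed.

(** Expanding [B x x] in the standard basis gives this polynomial, from which homogeneity,
    continuity and the quadratic bound are read off. *)
Lemma quadratic_formE (R : realType) (n : nat) (q : 'rV[R]_n -> R) :
  is_quadratic_form q -> exists b : 'I_n -> 'I_n -> R,
    forall x, q x = \sum_i \sum_j x ord0 i * x ord0 j * b i j.
Proof.
move=> [B qE].
exists (fun i j => B (delta_mx ord0 i) (delta_mx ord0 j)) => x.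
have Bl u v : B u v = \sum_i u ord0 i * B (delta_mx ord0 i) v.
  rewrite {1}(row_sum_delta u) linear_sumlz.
  by apply: eq_bigr => i _; exact: linearZl_LR.
have Br u v : B u v = \sum_i v ord0 i * B u (delta_mx ord0 i).
  rewrite {1}(row_sum_delta v) linear_sumr.
  by apply: eq_bigr => i _; exact: linearZr_LR.
rewrite qE Bl; apply: eq_bigr => i _; rewrite Br mulr_sumr.
by apply: eq_bigr => j _; rewrite mulrA.
Qed.

Lemma quadratic_formZ (R : realType) (n : nat) (q : 'rV[R]_n -> R) a x :
  is_quadratic_form q -> q (a *: x) = a ^+ 2 * q x.
Proof.
move=> /quadratic_formE[b qE]; rewrite !qE mulr_sumr; apply: eq_bigr => i _.
by rewrite mulr_sumr; apply: eq_bigr => j _; rewrite !mxE; ring.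
Qed.

Lemma quadratic_form_continuous (R : realType) (n : nat) (q : 'rV[R]_n -> R) :
  is_quadratic_form q -> continuous q.
Proof.
move=> /quadratic_formE[b /funext ->].
apply: continuous_bigsum => i; apply: continuous_bigsum => j.
apply: continuous_mul; last exact: cst_continuous.
by apply: continuous_mul; exact: coord_continuous.
Qed.

(** The norm is the sup norm, so each coordinate is at most [|x|] in absolute value, and the sum of
    the absolute values of the coefficients serves as [K]. *)
Lemma quadratic_form_le (R : realType) (n : nat) (q : 'rV[R]_n -> R) :
  is_quadratic_form q -> exists2 K, 0 <= K & forall x, `|q x| <= K * `|x| ^+ 2.
Proof.
move=> /quadratic_formE[b qE].
exists (\sum_i \sum_j `|b i j|) => [|x].
  by apply: sumr_ge0 => i _; apply: sumr_ge0.
rewrite qE mulr_suml (le_trans (ler_norm_sum _ _ _))//; apply: ler_sum => i _.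
rewrite mulr_suml (le_trans (ler_norm_sum _ _ _))//; apply: ler_sum => j _.
rewrite !normrM [leRHS]mulrC ler_wpM2r// expr2.
by rewrite ler_pM// ler_coord_norm.
Qed.

Lemma pos_lower_bound_sphere (R : realType) (n : nat) (g : 'rV[R]_n -> R) :
  continuous g -> (forall x, `|x| = 1 -> 0 < g x) ->
  exists2 d, 0 < d & forall x, `|x| = 1 -> d <= g x.
Proof.
move=> gc g0; pose S : set 'rV[R]_n := [set x | `|x| = 1].
have [S0|/set0P/negP/negPn/eqP S0] := pselect (S !=set0); last first.
  (* The sphere is empty when [n = 0]; the bound is then vacuous and 1 is an arbitrary choice. *)
  by exists 1 => // x x1; have : S x by []; rewrite S0.
have Scompact : compact S.
  apply: bounded_closed_compact.
    by exists 1; split => // M M1 x /= ->; exact: ltW.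
  have -> : S = (fun x => `|x|) @^-1` [set 1 : R] by [].
  apply: closed_comp => [x _|]; first exact: norm_continuous.
  exact: closed_eq.
have [c cS cmin] := EVT_min_rV S0 Scompact (continuous_subspaceT gc).
exists (g c); first by apply: g0; move: cS; rewrite inE.
by move=> x x1; apply: cmin; rewrite inE.
Qed.

Lemma second_order_remainder (R : realType) (n : nat)
    (F l q : 'rV[R]_n -> R) :
  F = (fun x => l x + q x : R)
        +o_ (0 : 'rV[R]_n) (fun x : 'rV[R]_n => `|x| ^+ 2) ->
  forall e, 0 < e ->
    \forall x \near (0 : 'rV[R]_n), `|F x - (l x + q x)| <= e * `|x| ^+ 2.
Proof.
move=> /eqaddoP Fo e e0; near=> x.
have -> : `|x| ^+ 2 = `| `|x| ^+ 2 | by rewrite ger0_norm// sqr_ge0.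
by near: x; exact: Fo.
Unshelve. all: by end_near. Qed.

(** If [F x >= 0], then [l x] is at least minus [q x] minus the remainder, hence at least
    [-(K + 1) * |x|^2]; this is absorbed by [e * |x|] once [|x| <= e / (K + 1)]. *)
Lemma linear_part_lower_bound (R : realType) (n : nat)
    (F l q : 'rV[R]_n -> R) :
  is_quadratic_form q ->
  F = (fun x => l x + q x : R)
        +o_ (0 : 'rV[R]_n) (fun x : 'rV[R]_n => `|x| ^+ 2) ->
  forall e, 0 < e ->
    \forall x \near (0 : 'rV[R]_n), 0 <= F x -> - (e * `|x|) <= l x.
Proof.
move=> /quadratic_form_le[K K0 qK] /second_order_remainder Fo e e0; near=> x.
move=> Fx0.
have Fx : `|F x - (l x + q x)| <= 1 * `|x| ^+ 2 by near: x; exact: Fo.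
have xe : `|x| <= e / (K + 1).
  by near: x; apply: (@nbhs0_le _ 'rV[R]_n); rewrite divr_gt0// ltr_wpDl.
have {}xe : (K + 1) * `|x| ^+ 2 <= e * `|x|.
  rewrite expr2 mulrA ler_wpM2r// mulrC -ler_pdivlMr// ltr_wpDl//.
have := qK x; move: Fx; rewrite !ler_norml => /andP[? ?] /andP[? ?].
by lra.
Unshelve. all: by end_near. Qed.

Theorem theorem2 (R : realType) (m n : nat) (m_gt0 : (0 < m)%N)
    (le_mn : (m <= n)%N)
    (F : 'I_m -> 'rV[R]_n -> R)
    (F_analytic : forall u : 'I_m, \forall a \near (0 : 'rV[R]_n),
       analytic_at (F u) a)
    (F0 : forall u : 'I_m, F u 0 = 0)
    (l : 'I_m -> 'Hom('rV[R]_n, R^o))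
    (q : 'I_m -> 'rV[R]_n -> R)
    (q_quadratic : forall u : 'I_m, is_quadratic_form (q u))
    (F_expansion : forall u : 'I_m,
       F u = (fun x => l u x + q u x : R)
               +o_ (0 : 'rV[R]_n) (fun x : 'rV[R]_n => `|x| ^+ 2))
    (dim_span_l : \dim <<[seq l u | u : 'I_m]>>%VS = (m - 1)%N)
    (lambda : 'I_m -> R)
    (lambda_gt0 : forall u : 'I_m, 0 < lambda u)
    (lambda_rel : \sum_(u < m) lambda u *: l u = 0)
    (q_condition : forall xi : 'rV[R]_n,
       xi \in (\bigcap_(u < m) lker (l u))%VS ->
       0 <= \sum_(u < m) lambda u * q u xi -> xi = 0) :
  strict_local_max
    (fun x : 'rV[R]_n => \big[Num.min/F (Ordinal m_gt0) x]_(u < m) F u x) 0.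
Proof.
pose L := \sum_(u < m) lambda u.
have L_gt0 : 0 < L.
  rewrite /L (bigD1 (Ordinal m_gt0))//= ltr_pwDl ?lambda_gt0// sumr_ge0// => u _.
  exact: ltW.
have lambda_l0 x : \sum_(u < m) lambda u * l u x = 0.
  have := congr1 (fun f : 'Hom('rV[R]_n, R^o) => f x) lambda_rel.
  rewrite sum_lfunE zero_lfunE; apply: etrans.
  by apply: eq_bigr => u _; rewrite scale_lfunE.
pose Q x := \sum_(u < m) lambda u * q u x.
(* The first summand vanishes exactly on the common kernel of the [l u], the second exactly where
   [Q x >= 0]. *)
pose G x := \sum_(u < m) lambda u * `|l u x| + (`|Q x| - Q x).
have Qc : continuous Q.
  apply: continuous_bigsum => u; apply: continuous_mul; first exact: cst_continuous.
  exact: quadratic_form_continuous.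
have lc : continuous (fun x => \sum_(u < m) lambda u * `|l u x|).
  apply: continuous_bigsum => u; apply: continuous_mul.
    exact: cst_continuous.
  exact/continuous_abs/linear_form_continuous.
have Gc : continuous G.
  by move=> x; exact: cvgD (lc x) (cvgB (@continuous_abs _ _ Q Qc x) (Qc x)).
have G_gt0 x : `|x| = 1 -> 0 < G x.
  move=> x1; have l_ge0 : 0 <= \sum_(u < m) lambda u * `|l u x|.
    by apply: sumr_ge0 => u _; rewrite mulr_ge0// ltW.
  have Q_ge0 : 0 <= `|Q x| - Q x by rewrite subr_ge0 ler_norm.
  rewrite lt_neqAle eq_sym addr_ge0// andbT paddr_eq0//.
  apply/negP => /andP[/eqP/psumr_eq0P lx0 Qx0].
  suff x0 : x = 0 by move: x1; rewrite x0 normr0 => /esym/eqP; rewrite oner_eq0.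
  apply: q_condition; last first.
    by move: Qx0; rewrite subr_eq0 => /eqP; rewrite -/(Q x) => <-.
  apply/subv_bigcapP => u _; rewrite -memvE memv_ker.
  have /eqP := lx0 (fun v _ => mulr_ge0 (ltW (lambda_gt0 v)) (normr_ge0 _)) u isT.
  by rewrite mulf_eq0 gt_eqF//= normr_eq0.
have [d d0 Gd] := pos_lower_bound_sphere Gc G_gt0.
(* The estimates below bound [G] at the normalised point by [4 * L * e]; the factor 5 makes this
   less than [d]. *)
pose e := d / (5 * L).
have e0 : 0 < e by rewrite divr_gt0// mulr_gt0.
have F_near : \forall x \near (0 : 'rV[R]_n), forall u : 'I_m,
    `|F u x - (l u x + q u x)| <= e * `|x| ^+ 2 /\
    (0 <= F u x -> - (e * `|x|) <= l u x).
  (* As there are finitely many indices, one neighbourhood serves them all. *)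
  apply: (@filter_forall _ _ _ (nbhs (0 : 'rV[R]_n))) => u; apply: filterI.
    exact: second_order_remainder (F_expansion u) _ e0.
  exact: linear_part_lower_bound (q_quadratic u) (F_expansion u) _ e0.
rewrite /strict_local_max; near=> x.
have x_neq0 : x != 0 by near: x; exact: nbhs_dnbhs_neq.
have Fx : forall u : 'I_m,
    `|F u x - (l u x + q u x)| <= e * `|x| ^+ 2 /\
    (0 <= F u x -> - (e * `|x|) <= l u x).
  by near: x; apply: nbhs_dnbhs; exact: F_near.
(* The default value of the minimum is itself one of the [F u], so at the origin every entry is
   0. *)
rewrite [ltRHS](_ : _ = 0); last first.
  by apply: (big_ind (fun y : R => y = 0)) => // a b -> ->; rewrite minxx.
rewrite ltNge; apply/negP => /bigmin_geP[_ F_ge0].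
have r0 : 0 < `|x| by rewrite normr_gt0.
have := Gd (`|x|^-1 *: x).
rewrite normrZ normfV normr_id mulVf ?gt_eqF// => /(_ erefl); apply/negP.
rewrite -ltNge.
have {}F_ge0 u : 0 <= F u x by exact: F_ge0.
have l_le : \sum_(u < m) lambda u * `|l u (`|x|^-1 *: x)| <= 2 * L * e.
  (* A number [t >= - e] satisfies [|t| <= t + 2 * e]; summing with weights [lambda u] cancels the
     terms [t]. *)
  have -> : 2 * L * e = \sum_(u < m) lambda u * (l u (`|x|^-1 *: x) + 2 * e).
    under eq_bigr do rewrite mulrDr.
    by rewrite big_split/= lambda_l0 add0r -mulr_suml -/L; ring.
  apply: ler_sum => u _; rewrite ler_pM2l//.
  have lu : - e <= l u (`|x|^-1 *: x).
    rewrite linear_formZ.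
    rewrite mulrC ler_pdivlMr// mulNr.
    by have [_] := Fx u; exact.
  by rewrite ler_norml; apply/andP; split; lra.
have Q_ge : - (L * e) <= Q (`|x|^-1 *: x).
  (* The added linear terms have weighted sum zero. With them each bracket becomes
     [(q u x + l u x) / |x|^2], which is at least [- e] because [F u x >= 0] and the remainder is at
     most [e * |x|^2]. *)
  have -> : Q (`|x|^-1 *: x) =
      \sum_(u < m) lambda u * (q u (`|x|^-1 *: x) + l u (`|x|^-2 *: x)).
    under eq_bigr do rewrite mulrDr.
    by rewrite big_split/= lambda_l0 addr0.
  rewrite /L mulr_suml -sumrN.
  apply: ler_sum => u _; rewrite -mulrN ler_pM2l//.
  rewrite quadratic_formZ// linear_formZ.
  rewrite exprVn -mulrDr mulrC ler_pdivlMr ?exprn_gt0// mulNr.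
  have [+ _] := Fx u; rewrite ler_norml => /andP[_].
  by have := F_ge0 u; lra.
have eL : L * e = d / 5 by rewrite /e; field; rewrite gt_eqF.
(* The term [|Q| - Q] is 0 if [Q >= 0] and [-2 * Q <= 2 * L * e] otherwise, so [G] is at most
   [4 * d / 5]. *)
have [|] := lerP 0 (Q (`|x|^-1 *: x)) => Qx; rewrite /G.
  by rewrite (ger0_norm Qx); lra.
by rewrite (ltr0_norm Qx); lra.
Unshelve. all: by end_near. Qed.
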